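(* The number $e$ is irrational.
   Context: Here $e$ denotes Euler's number, the base of the natural logarithm, $e = \sum_{n=0}^{\infty} \frac{1}{n!}$. *)

(* Defs.v *)
From mathcomp Require Import all_boot all_order all_algebra.
From mathcomp Require Import all_classical all_reals all_analysis.

Set Implicit Arguments.
Unset Strict Implicit.
Unset Printing Implicit Defensive.

Import Order.TTheory GRing.Theory Num.Theory.
Import numFieldNormedType.Exports.

Local Open Scope classical_set_scope.
Local Open Scope ring_scope.

Definition euler_number (R : realType) : R :=
  limn (series (fun n : nat => (n`!%:R)^-1 : R)).

Lemma euler_number_expR1 (R : realType) : euler_number R = expR 1.
Proof.
rewrite /euler_number /expR exp_coeffE.
by under [in RHS]eq_fun do rewrite expr1n mulr1.
Qed.

(* [limn] is total, so this is what makes [euler_number] the sum of the series. *)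
Lemma euler_number_cvg (R : realType) :
  series (fun n : nat => (n`!%:R)^-1 : R) @ \oo --> euler_number R.
Proof.
have := @is_cvg_series_exp_coeff R 1; rewrite exp_coeffE.
by under eq_fun do rewrite expr1n mulr1.
Qed.

(* Main.v *)
(** Let s_n = 1/0! + ... + 1/n!.  For n >= 2 the sequence s_n + 1/n! is strictly
    decreasing, so s_n < e < s_n + 1/n!.  After multiplication by n!, the number
    n! e lies strictly between two consecutive integers; but if e = a/b, then
    n! e is an integer as soon as n >= b. *)

Require Import Defs.
From mathcomp Require Import all_boot all_order all_algebra.
From mathcomp Require Import all_classical all_reals all_analysis.

Import Order.TTheory GRing.Theory Num.Theory.

Local Open Scope ring_scope.

Local Notation inv_fact R := (fun n : nat => (n`!%:R)^-1 : R).

Lemma inv_fact_gt0 (R : realType) (n : nat) : 0 < inv_fact R n.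
Proof. by rewrite invr_gt0 ltr0n fact_gt0. Qed.

(** Two copies of 1/(n+1)! fit into 1/n!, so s_n + 1/n! does not increase. *)
Lemma inv_factS_le_half (R : realType) (n : nat) :
  (0 < n)%N -> inv_fact R n.+1 * 2 <= inv_fact R n.
Proof.
move=> n_gt0 /=; rewrite factS natrM invfM mulrAC.
rewrite ler_piMl ?(ltW (inv_fact_gt0 _ _))//.
by rewrite mulrC ler_pdivrMr ?ltr0n// mul1r ler_nat.
Qed.

Lemma inv_factS_lt_half (R : realType) (n : nat) :
  (1 < n)%N -> inv_fact R n.+1 * 2 < inv_fact R n.
Proof.
move=> n_gt1 /=; rewrite factS natrM invfM mulrAC gtr_pMl ?inv_fact_gt0//.
by rewrite mulrC ltr_pdivrMr ?ltr0n// mul1r ltr_nat.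
Qed.

Lemma series_inv_fact_lt_euler (R : realType) (n : nat) :
  series (inv_fact R) n < euler_number R.
Proof.
(* A limit preserves only weak bounds; one extra positive term makes this one strict. *)
apply: (@lt_le_trans _ _ (series (inv_fact R) n.+1)).
  by rewrite seriesSr ltrDl inv_fact_gt0.
apply: (cvgr_to_ge (euler_number_cvg (R := R))); exists n.+1 => // m le_nm.
by rewrite (increasing_series (inv_fact_gt0 R)).
Qed.

Lemma euler_le_series_inv_fact (R : realType) (n : nat) :
  (0 < n)%N -> euler_number R <= series (inv_fact R) n.+1 + inv_fact R n.
Proof.
move=> n_gt0; apply: (cvgr_to_le (euler_number_cvg (R := R))).
exists n.+1 => // -[|m]//; rewrite /= ltnS => le_nm.
(* [series _ m.+1] is s_m, as [series] stops before its index; s_m + 1/m! then descends to its value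
   at n. *)
apply: (@le_trans _ _ (series (inv_fact R) m.+1 + inv_fact R m)).
  by rewrite lerDl ltW ?inv_fact_gt0.
elim: m le_nm => [|m IHm]; first by rewrite leqn0 => /eqP ->.
rewrite leq_eqVlt => /predU1P[-> //|]; rewrite ltnS => le_nm.
apply: le_trans (IHm le_nm).
rewrite seriesSr -addrA lerD2l -mulr2n -[_ *+ 2]mulr_natr.
by apply: inv_factS_le_half; exact: leq_trans le_nm.
Qed.

(** Strictness comes from the weak bound at n+1, which lies strictly below the bound at n. *)
Lemma euler_lt_series_inv_fact (R : realType) (n : nat) :
  (1 < n)%N -> euler_number R < series (inv_fact R) n.+1 + inv_fact R n.
Proof.
move=> n_gt1; apply: (le_lt_trans (euler_le_series_inv_fact R n.+1 _)) => //.
by rewrite seriesSr -addrA ltrD2l -mulr2n -[_ *+ 2]mulr_natr inv_factS_lt_half.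
Qed.

Lemma fact_mul_series_int (R : realType) (n : nat) :
  n`!%:R * series (inv_fact R) n.+1 \is a Num.int.
Proof.
(* Termwise, n!/k! = C(n,k) (n-k)! for k <= n. *)
rewrite seriesEnat /= mulr_sumr big_nat rpred_sum// => k /andP[_].
rewrite ltnS => le_kn; rewrite -(bin_fact le_kn) mulnCA natrM mulrAC divff.
  by rewrite mul1r rpred_nat.
by rewrite pnatr_eq0 -lt0n fact_gt0.
Qed.

(* The junk case [b = 0] is harmless: then [a%:~R / b%:R = 0]. *)
Lemma fact_mul_frac_int (R : realType) (a : int) (b n : nat) :
  (b <= n)%N -> n`!%:R * (a%:~R / b%:R) \is a @Num.int R.
Proof.
case: b => [|b] le_bn; first by rewrite invr0 !mulr0 rpred0.
have /dvdnP[k ->] := dvdn_fact (m := b.+1) le_bn.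
rewrite mulrCA natrM mulfK ?pnatr_eq0// rpredM ?rpred_nat//.
exact: intr_int.
Qed.

Theorem theorem1 (R : realType) : irrational (euler_number R).
Proof.
(* This choice ensures both n >= b and n > 1. *)
move=> /rationalP[a [b e_frac]]; pose n := b.+2.
have fact_n_gt0 : 0 < n`!%:R :> R by rewrite ltr0n fact_gt0.
have /intrP[p e_int] : n`!%:R * euler_number R \is a Num.int.
  by rewrite e_frac; apply: fact_mul_frac_int; rewrite ltnW.
have /intrP[q s_int] := fact_mul_series_int R n.
have := series_inv_fact_lt_euler R n.+1.
rewrite -(ltr_pM2l fact_n_gt0) e_int s_int ltr_int => lt_qp.
have := euler_lt_series_inv_fact R n isT.
rewrite -(ltr_pM2l fact_n_gt0) mulrDr mulfV ?gt_eqF// e_int s_int.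
(* The integers now satisfy q < p < q + 1, which is absurd. *)
by rewrite -(intrD _ q 1) ltr_int ltzD1 leNgt lt_qp.
Qed.
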